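(* Let $n\ge 2$, let $P=(p_1,\dots,p_n)$, $Q=(q_1,\dots,q_n)\in\Gamma_n$, and let $r,R$ be real numbers with $0<r\le \frac{p_i}{q_i}\le R<\infty$ for all $i\in\{1,\dots,n\}$. Then for every real $s\le 0$, $$\frac{1+r}{r^s}\,\Phi_s(P\|Q)\ \le\ J(P\|Q)\ \le\ \frac{1+R}{R^s}\,\Phi_s(P\|Q),$$ and for every real $s\ge 1$, $$\frac{1+R}{R^s}\,\Phi_s(P\|Q)\ \le\ J(P\|Q)\ \le\ \frac{1+r}{r^s}\,\Phi_s(P\|Q).$$
   Context: For $n\ge2$, $\Gamma_n=\{P=(p_1,\dots,p_n): p_i>0,\ \sum_{i=1}^n p_i=1\}$. For $P,Q\in\Gamma_n$ and $s\in\mathbb{R}$, the relative information of type $s$ is $\Phi_s(P\|Q)=[s(s-1)]^{-1}\left[\sum_{i=1}^n p_i^s q_i^{1-s}-1\right]$ for $s\ne 0,1$; $\Phi_0(P\|Q)=\sum_{i=1}^n q_i\ln\frac{q_i}{p_i}$; $\Phi_1(P\|Q)=\sum_{i=1}^n p_i\ln\frac{p_i}{q_i}$. The J-divergence is $J(P\|Q)=\sum_{i=1}^n (p_i-q_i)\ln\left(\frac{p_i}{q_i}\right)$. *)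

(* Defs.v *)
From mathcomp Require Import all_boot all_order all_algebra.
From mathcomp Require Import all_classical all_reals all_analysis.

Set Implicit Arguments.
Unset Strict Implicit.
Unset Printing Implicit Defensive.

Import Order.TTheory GRing.Theory Num.Theory.

Local Open Scope ring_scope.
Local Open Scope classical_set_scope.

Definition Gamma (K : realType) (n : nat) : set ('I_n -> K) :=
  [set P | (forall i, 0 < P i) /\ \sum_(i < n) P i = 1].

Definition Phi (K : realType) (n : nat) (s : K) (P Q : 'I_n -> K) : K :=
  if s == 0 then \sum_(i < n) Q i * ln (Q i / P i)
  else if s == 1 then \sum_(i < n) P i * ln (P i / Q i)
  else (s * (s - 1))^-1 *
       ((\sum_(i < n) P i `^ s * Q i `^ (1 - s)) - 1).

Definition Jdiv (K : realType) (n : nat) (P Q : 'I_n -> K) : K :=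
  \sum_(i < n) (P i - Q i) * ln (P i / Q i).

(* Main.v *)
Require Import Defs.
From mathcomp Require Import all_boot all_order all_algebra.
From mathcomp Require Import all_classical all_reals all_analysis.
From mathcomp Require Import ring lra.

Import Order.TTheory GRing.Theory Num.Theory.
Import numFieldNormedType.Exports.

Local Open Scope ring_scope.
Local Open Scope classical_set_scope.

(** Both divergences are Csiszar divergences: a sum over [i] of
    [Q i * f (P i / Q i)], where the generator [f] is
    [(x - 1) * ln x] for [J] and, for [Phi s], the solution of
    [f'' x = x `^ (s - 2)] with [f 1 = f' 1 = 0].  Normalizing the generator of
    [Phi s] in this way adds to it a multiple of [x - 1], which contributes
    nothing because [P] and [Q] both have total mass [1].

    Since [Q] is positive, a Csiszar divergence is monotone in the generator on
    the range [r, R] of the ratios ([csiszar_le]), so the theorem is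
    a pointwise comparison of the generator of [J] with a constant multiple of
    that of [Phi s].  Both vanish to first order at [1], and [1] lies between
    [r] and [R] because it is the [Q]-average of the ratios; hence it is
    enough to compare second derivatives ([le_of_second_derivative]).  That of
    [(x - 1) * ln x] is [(1 + x) / x ^+ 2], which is [(1 + x) / x `^ s] times
    [x `^ (s - 2)], so the admissible constants are the bounds of
    [(1 + x) / x `^ s] on [r, R].  That function is nondecreasing for [s <= 0]
    and nonincreasing for [1 <= s], so its bounds are its values at [r] and
    [R], in one order or the other. *)

(** * Comparison of functions through their second derivatives *)

(** The sign condition keeps track of the side of [c] on which the intermediate
    point lies, so that both sides of [c] are treated by one argument when the
    mean value theorem is used twice. *)
Lemma MVT_from {K : realType} (f df : K -> K) (a b c x : K) :
  (forall y, y \in `[a, b]%R -> is_derive y 1 f (df y)) ->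
  c \in `[a, b]%R -> x \in `[a, b]%R ->
  exists t, [/\ t \in `[a, b]%R, 0 <= (t - c) * (x - c) &
                f x - f c = df t * (x - c)].
Proof.
move=> Df; rewrite !in_itv /= => /andP[ac cb] /andP[ax xb].
have cont u v : a <= u -> v <= b -> {within `[u, v], continuous f}.
  move=> au vb; apply: derivable_within_continuous => y.
  rewrite in_itv /= => /andP[uy yv].
  have /Df[] // : y \in `[a, b]%R.
  by rewrite in_itv /= (le_trans au uy) (le_trans yv vb).
have Df' u v y : a <= u -> v <= b -> y \in `]u, v[%R -> is_derive y 1 f (df y).
  move=> au vb; rewrite in_itv /= => /andP[uy yv]; apply: Df.
  by rewrite in_itv /= (le_trans au (ltW uy)) (le_trans (ltW yv) vb).
case: (leP c x) => [cx|/ltW xc].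
  have [t + ft] := MVT_segment cx (fun y => Df' c x y ac xb) (cont c x ac xb).
  rewrite in_itv /= => /andP[ct tx]; exists t; split => //.
    by rewrite in_itv /= (le_trans ac ct) (le_trans tx xb).
  by rewrite mulr_ge0 ?subr_ge0.
have [t + ft] := MVT_segment xc (fun y => Df' x c y ax cb) (cont x c ax cb).
rewrite in_itv /= => /andP[xt tc]; exists t; split => //.
- by rewrite in_itv /= (le_trans ax xt) (le_trans tc cb).
- by rewrite mulr_le0 ?subr_le0.
- by rewrite -opprB ft -mulrN opprB.
Qed.

(** By the mean value theorem applied to [g - f] and then to its derivative,
    [(g - f) x] is [(g - f)'' t'] times [(t - c) * (x - c)], where [t] and [x]
    are on the same side of [c]. *)
Lemma le_of_second_derivative {K : realType} (f f1 f2 g g1 g2 : K -> K)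
    (a b c : K) :
  (forall y, y \in `[a, b]%R -> is_derive y 1 f (f1 y)) ->
  (forall y, y \in `[a, b]%R -> is_derive y 1 f1 (f2 y)) ->
  (forall y, y \in `[a, b]%R -> is_derive y 1 g (g1 y)) ->
  (forall y, y \in `[a, b]%R -> is_derive y 1 g1 (g2 y)) ->
  c \in `[a, b]%R -> f c = g c -> f1 c = g1 c ->
  (forall y, y \in `[a, b]%R -> f2 y <= g2 y) ->
  forall x, x \in `[a, b]%R -> f x <= g x.
Proof.
move=> Df Df1 Dg Dg1 cab fgc fgc1 le2 x xab.
have D y : y \in `[a, b]%R -> is_derive y 1 (g - f) ((g1 - f1) y).
  by move=> yab; apply: is_deriveB; [exact: Dg|exact: Df].
have D1 y : y \in `[a, b]%R -> is_derive y 1 (g1 - f1) ((g2 - f2) y).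
  by move=> yab; apply: is_deriveB; [exact: Dg1|exact: Df1].
have [t [tab tx]] := MVT_from _ _ _ _ _ _ D cab xab.
have [u [uab _]] := MVT_from _ _ _ _ _ _ D1 cab tab.
rewrite !fctE fgc fgc1 !subrr !subr0 => -> ex.
rewrite -subr_ge0 ex -mulrA mulr_ge0 ?subr_ge0 //; exact: le2.
Qed.

(** * The generators *)

Definition Jgen {K : realType} (x : K) : K := (x - 1) * ln x.

Definition Jgen' {K : realType} (x : K) : K := ln x + (x - 1) / x.

(** Among the generators of [Phi s], which differ by multiples of [x - 1],
    the one that is stationary at [1]. *)
Definition Phigen {K : realType} (s x : K) : K :=
  if s == 0 then x - 1 - ln x
  else if s == 1 then x * ln x - (x - 1)
  else (s * (s - 1))^-1 * (x `^ s - 1 - s * (x - 1)).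

Definition Phigen' {K : realType} (s x : K) : K :=
  if s == 1 then ln x else (s - 1)^-1 * (x `^ (s - 1) - 1).

Lemma is_derive_Jgen {K : realType} (x : K) : 0 < x ->
  is_derive x 1 Jgen (Jgen' x).
Proof.
move=> x0; have Dln := is_derive1_ln x0.
have D : is_derive x 1 ((id - cst 1) * @ln K : K -> K) _ :=
  is_deriveM (is_deriveB (is_derive_id (x : K) 1) (is_derive_cst (1 : K) x 1)) Dln.
by apply: (is_derive_eq D); rewrite /Jgen' !fctE /GRing.scale /=; ring.
Qed.

Lemma is_derive_Jgen' {K : realType} (x : K) : 0 < x ->
  is_derive x 1 Jgen' ((1 + x) / x ^+ 2).
Proof.
move=> x0; have Dln := is_derive1_ln x0.
have xN0 : x != 0 by rewrite gt_eqF.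
have DV := is_deriveV xN0 (is_derive_id (x : K) 1).
have D : is_derive x 1 (@ln K + (id - cst 1) * (fun y : K => y^-1) : K -> K) _
  := is_deriveD Dln (is_deriveM
       (is_deriveB (is_derive_id (x : K) 1) (is_derive_cst (1 : K) x 1)) DV).
by apply: (is_derive_eq D); rewrite !fctE /GRing.scale /=; field.
Qed.

Lemma is_derive_Phigen {K : realType} (s x : K) : 0 < x ->
  is_derive x 1 (Phigen s) (Phigen' s x).
Proof.
move=> x0; have Dln := is_derive1_ln x0.
have xN0 : x != 0 by rewrite gt_eqF.
have D1 := is_deriveB (is_derive_id (x : K) 1) (is_derive_cst (1 : K) x 1).
have [->|s0] := eqVneq s 0.
  have D : is_derive x 1 (id - cst 1 - @ln K : K -> K) _ := is_deriveB D1 Dln.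
  have -> : Phigen 0 = id - cst 1 - @ln K by apply/funext => y; rewrite /Phigen eqxx.
  apply: (is_derive_eq D).
  rewrite /Phigen' eq_sym oner_eq0 sub0r invrN1 powR_inv1 ?ltW //.
  by ring.
have [->|s1] := eqVneq s 1.
  have D : is_derive x 1 (id * @ln K - (id - cst 1) : K -> K) _ :=
    is_deriveB (is_deriveM (is_derive_id (x : K) 1) Dln) D1.
  have -> : Phigen 1 = id * @ln K - (id - cst 1).
    by apply/funext => y; rewrite /Phigen oner_eq0 eqxx.
  apply: (is_derive_eq D); rewrite /Phigen' eqxx /GRing.scale /=.
  by rewrite divff //; ring.
have D : is_derive x 1
    ((s * (s - 1))^-1 \*: ((@powR K)^~ s - cst 1 - s \*: (id - cst 1))) _ :=
  is_deriveZ (s * (s - 1))^-1 (is_deriveB (is_deriveB (is_derive1_powR s x0)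
    (is_derive_cst (1 : K) x 1)) (is_deriveZ s D1)).
have -> : Phigen s =
    (s * (s - 1))^-1 \*: ((@powR K)^~ s - cst 1 - s \*: (id - cst 1)).
  by apply/funext => y; rewrite /Phigen (negbTE s0) (negbTE s1).
apply: (is_derive_eq D); rewrite /Phigen' (negbTE s1) /GRing.scale /=.
by field; rewrite subr_eq0 s1 s0.
Qed.

Lemma is_derive_Phigen' {K : realType} (s x : K) : 0 < x ->
  is_derive x 1 (Phigen' s) (x `^ (s - 2)).
Proof.
move=> x0.
have [->|s1] := eqVneq s 1.
  have -> : Phigen' 1 = @ln K by apply/funext => y; rewrite /Phigen' eqxx.
  apply: (is_derive_eq (is_derive1_ln x0)).
  by rewrite -powR_inv1 ?ltW //; congr powR; ring.
have D : is_derive x 1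
    ((s - 1)^-1 \*: ((@powR K)^~ (s - 1) - cst 1)) _ :=
  is_deriveZ (s - 1)^-1 (is_deriveB (is_derive1_powR (s - 1) x0)
    (is_derive_cst (1 : K) x 1)).
have -> : Phigen' s = (s - 1)^-1 \*: ((@powR K)^~ (s - 1) - cst 1).
  by apply/funext => y; rewrite /Phigen' (negbTE s1).
apply: (is_derive_eq D); rewrite subr0 /GRing.scale /= mulrA mulVf ?subr_eq0 //.
by rewrite mul1r; congr powR; ring.
Qed.

Lemma Jgen1 {K : realType} : Jgen (1 : K) = 0.
Proof. by rewrite /Jgen subrr mul0r. Qed.

Lemma Jgen'1 {K : realType} : Jgen' (1 : K) = 0.
Proof. by rewrite /Jgen' ln1 subrr mul0r addr0. Qed.

Lemma Phigen1 {K : realType} (s : K) : Phigen s 1 = 0.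
Proof.
by rewrite /Phigen powR1 ln1 !subrr !mulr0 !subr0 mulr0 !if_same.
Qed.

Lemma Phigen'1 {K : realType} (s : K) : Phigen' s 1 = 0.
Proof. by rewrite /Phigen' powR1 ln1 !subrr mulr0 if_same. Qed.

(** * The ratio of the second derivatives *)

Lemma second_derivative_ratio {K : realType} (s x : K) : 0 < x ->
  (1 + x) / x ^+ 2 = (1 + x) / x `^ s * x `^ (s - 2).
Proof.
move=> x0; have xN0 : x != 0 by rewrite gt_eqF.
rewrite powRB ?xN0 ?implybT // (powR_mulrn 2) ?ltW //.
by field; rewrite xN0 gt_eqF // powR_gt0.
Qed.

Lemma le0_ger_powR {K : realType} (a x y : K) :
  a <= 0 -> 0 < x -> x <= y -> y `^ a <= x `^ a.
Proof.
move=> a0 x0 xy; have y0 := lt_le_trans x0 xy.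
rewrite -[a]opprK ![_ `^ - - a]powRN lef_pV2 ?posrE ?powR_gt0 //.
by rewrite ge0_ler_powR ?oppr_ge0 // nnegrE ltW.
Qed.

Lemma ratio_nondecreasing {K : realType} (s x y : K) :
  s <= 0 -> 0 < x -> x <= y -> (1 + x) / x `^ s <= (1 + y) / y `^ s.
Proof.
move=> s0 x0 xy; have y0 := lt_le_trans x0 xy.
apply: ler_pM; rewrite ?invr_ge0 ?powR_ge0 ?addr_ge0 ?lerD2l //; first exact: ltW.
by rewrite lef_pV2 ?posrE ?powR_gt0 // le0_ger_powR.
Qed.

(** Expanding the quotient leaves two powers with nonpositive exponents. *)
Lemma ratio_nonincreasing {K : realType} (s x y : K) :
  1 <= s -> 0 < x -> x <= y -> (1 + y) / y `^ s <= (1 + x) / x `^ s.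
Proof.
move=> s1 x0 xy; have y0 := lt_le_trans x0 xy.
have E z : 0 < z -> (1 + z) / z `^ s = z `^ (- s) + z `^ (1 - s).
  move=> z0; rewrite powRB ?(gt_eqF z0) ?implybT // powRr1 ?ltW // powRN.
  by rewrite mulrDl mul1r.
by rewrite !E // lerD // le0_ger_powR //; lra.
Qed.

(** * Csiszar divergences *)

Definition csiszar {K : realType} {n : nat} (f : K -> K) (P Q : 'I_n -> K) : K :=
  \sum_(i < n) Q i * f (P i / Q i).

Lemma csiszar_le {K : realType} {n : nat} (f g : K -> K) (P Q : 'I_n -> K) :
  (forall i, 0 <= Q i) -> (forall i, f (P i / Q i) <= g (P i / Q i)) ->
  csiszar f P Q <= csiszar g P Q.
Proof. by move=> Q0 fg; apply: ler_sum => i _; rewrite ler_wpM2l. Qed.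

Lemma csiszarZ {K : realType} {n : nat} (k : K) (f : K -> K)
    (P Q : 'I_n -> K) :
  csiszar (k \*: f) P Q = k * csiszar f P Q.
Proof.
by rewrite mulr_sumr; apply: eq_bigr => i _; rewrite mulrCA.
Qed.

Lemma Jdiv_csiszar {K : realType} {n : nat} (P Q : 'I_n -> K) :
  Gamma Q -> Jdiv P Q = csiszar Jgen P Q.
Proof.
case=> Q0 _; apply: eq_bigr => i _; rewrite /Jgen.
have QN0 : Q i != 0 by rewrite gt_eqF.
by rewrite mulrA mulrBr mulr1 mulrCA divff ?mulr1.
Qed.

Lemma Phi_csiszar {K : realType} {n : nat} (s : K) (P Q : 'I_n -> K) :
  Gamma P -> Gamma Q -> Phi s P Q = csiszar (Phigen s) P Q.
Proof.
case=> P0 P1 [Q0 Q1]; rewrite /Phi /csiszar /Phigen.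
have QN0 i : Q i != 0 by rewrite gt_eqF.
(* The linear term of the generator has divergence zero. *)
have lin : \sum_(i < n) Q i * (P i / Q i - 1) = 0.
  under eq_bigr => i _ do rewrite mulrBr mulr1 mulrCA divff // mulr1.
  by rewrite sumrB P1 Q1 subrr.
case: ifP => _; [|case: ifP => _].
- under [RHS]eq_bigr => i _ do rewrite mulrBr.
  rewrite sumrB lin sub0r -sumrN; apply: eq_bigr => i _.
  by rewrite -mulrN -lnV ?posrE ?divr_gt0 // invf_div.
- under [RHS]eq_bigr => i _ do rewrite mulrBr mulrA mulrCA divff // mulr1.
  by rewrite sumrB lin subr0.
- under [RHS]eq_bigr => i _ do rewrite mulrCA.
  rewrite -mulr_sumr; congr (_ * _).
  under [RHS]eq_bigr => i _ do rewrite mulrBr mulrBr mulr1 [_ * (s * _)]mulrCA.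
  rewrite !sumrB -mulr_sumr lin mulr0 subr0 Q1; congr (_ - _).
  apply: eq_bigr => i _.
  rewrite powRM ?invr_ge0 ?ltW // powRB ?QN0 ?implybT // powRr1 ?ltW //.
have -> : (Q i)^-1 `^ s = (Q i `^ s)^-1.
  by rewrite -[(Q i)^-1]powR_inv1 ?ltW // powRAC powR_inv1 ?powR_ge0.
exact: mulrCA.
Qed.

(** [1] is the average of the ratios [P i / Q i] with weights [Q i]. *)
Lemma one_between_ratios {K : realType} {n : nat} (P Q : 'I_n -> K) (r R : K) :
  Gamma P -> Gamma Q -> (forall i, r <= P i / Q i <= R) -> r <= 1 <= R.
Proof.
case=> _ P1 [Q0 Q1] rR.
have rE k : k = \sum_(i < n) k * Q i by rewrite -mulr_sumr Q1 mulr1.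
apply/andP; split; [rewrite [r]rE | rewrite [R]rE]; rewrite -P1;
  apply: ler_sum => i _; have /andP[] := rR i.
- by rewrite ler_pdivlMr.
- by rewrite ler_pdivrMr.
Qed.

(** * The bounds on [J] *)

Lemma Phi_le_Jdiv {K : realType} {n : nat} (P Q : 'I_n -> K) (r R s k : K) :
  Gamma P -> Gamma Q -> 0 < r -> (forall i, r <= P i / Q i <= R) ->
  (forall x, r <= x <= R -> k <= (1 + x) / x `^ s) ->
  k * Phi s P Q <= Jdiv P Q.
Proof.
move=> hP hQ r0 rR hk; have oneI := one_between_ratios _ _ _ _ hP hQ rR.
have pos x : x \in `[r, R]%R -> 0 < x.
  by rewrite in_itv /= => /andP[rx _]; exact: lt_le_trans rx.
rewrite Jdiv_csiszar // Phi_csiszar // -csiszarZ.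
apply: csiszar_le => [i|i]; first by case: hQ => /(_ i)/ltW.
apply: (@le_of_second_derivative K _ (k \*: Phigen' s)
          (fun x => k *: x `^ (s - 2)) _ Jgen' (fun x => (1 + x) / x ^+ 2)
          r R 1) => [y /pos y0|y /pos y0|y /pos y0|y /pos y0|||| y yI|].
- exact: (is_deriveZ k (is_derive_Phigen s y y0)).
- exact: (is_deriveZ k (is_derive_Phigen' s y y0)).
- exact: is_derive_Jgen.
- exact: is_derive_Jgen'.
- by rewrite in_itv.
- by rewrite /= Phigen1 Jgen1 scaler0.
- by rewrite /= Phigen'1 Jgen'1 scaler0.
- rewrite (second_derivative_ratio s) ?pos //.
  by rewrite ler_wpM2r ?powR_ge0 // hk.
- by rewrite in_itv; exact: rR.
Qed.

Lemma Jdiv_le_Phi {K : realType} {n : nat} (P Q : 'I_n -> K) (r R s k : K) :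
  Gamma P -> Gamma Q -> 0 < r -> (forall i, r <= P i / Q i <= R) ->
  (forall x, r <= x <= R -> (1 + x) / x `^ s <= k) ->
  Jdiv P Q <= k * Phi s P Q.
Proof.
move=> hP hQ r0 rR hk; have oneI := one_between_ratios _ _ _ _ hP hQ rR.
have pos x : x \in `[r, R]%R -> 0 < x.
  by rewrite in_itv /= => /andP[rx _]; exact: lt_le_trans rx.
rewrite Jdiv_csiszar // Phi_csiszar // -csiszarZ.
apply: csiszar_le => [i|i]; first by case: hQ => /(_ i)/ltW.
apply: (@le_of_second_derivative K _ Jgen' (fun x => (1 + x) / x ^+ 2)
          _ (k \*: Phigen' s) (fun x => k *: x `^ (s - 2))
          r R 1) => [y /pos y0|y /pos y0|y /pos y0|y /pos y0|||| y yI|].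
- exact: is_derive_Jgen.
- exact: is_derive_Jgen'.
- exact: (is_deriveZ k (is_derive_Phigen s y y0)).
- exact: (is_deriveZ k (is_derive_Phigen' s y y0)).
- by rewrite in_itv.
- by rewrite /= Phigen1 Jgen1 scaler0.
- by rewrite /= Phigen'1 Jgen'1 scaler0.
- rewrite (second_derivative_ratio s) ?pos //.
  by rewrite ler_wpM2r ?powR_ge0 // hk.
- by rewrite in_itv; exact: rR.
Qed.

Theorem theorem5p1 (K : realType) (n : nat) (hn : (2 <= n)%N)
  (P Q : 'I_n -> K) (hP : Gamma P) (hQ : Gamma Q)
  (r R : K) (hr : 0 < r) (hrR : forall i : 'I_n, r <= P i / Q i <= R) :
  (forall s : K, s <= 0 ->
     (1 + r) / r `^ s * Phi s P Q <= Jdiv P Q <= (1 + R) / R `^ s * Phi s P Q)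
  /\
  (forall s : K, 1 <= s ->
     (1 + R) / R `^ s * Phi s P Q <= Jdiv P Q <= (1 + r) / r `^ s * Phi s P Q).
Proof.
split=> s hs; apply/andP; split.
- apply: (Phi_le_Jdiv P Q r R s) => // x /andP[rx _].
  exact: ratio_nondecreasing.
- apply: (Jdiv_le_Phi P Q r R s) => // x /andP[rx xR].
  exact: ratio_nondecreasing hs (lt_le_trans hr rx) xR.
- apply: (Phi_le_Jdiv P Q r R s) => // x /andP[rx xR].
  exact: ratio_nonincreasing hs (lt_le_trans hr rx) xR.
- apply: (Jdiv_le_Phi P Q r R s) => // x /andP[rx _].
  exact: ratio_nonincreasing.
Qed.
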